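(* Let $a>b$ be relatively prime positive integers and let $\omega,\omega'\in\mathcal{D}(a,b)$. Suppose there are positive integers $k,l$ such that some cyclic shift of the period of $g(\omega')$ is of type $(k,l)$. Suppose further that for all positive integers $i,j$ such that some cyclic shift of the period of $g(\omega)$ is of type $(i,j)$, we have either ($i<k$ and $j<l$) or ($i<l$ and $j<k$). Then $L(\omega)<L(\omega')$.
   Context: A lattice path from $(0,0)$ to $(a,b)$ is a word in the letters $R$ (unit step right) and $U$ (unit step up) with $a$ letters $R$ and $b$ letters $U$; $\mathcal{D}(a,b)$ is the set of such paths lying (weakly) below the line $y=\frac bax$. For a word $W=w_1\cdots w_n$, $f(W)=[a_0,\ldots,a_t]$ is the finite continued fraction whose entry sequence is obtained by scanning $i=1,\ldots,n-1$ and appending $1,1$ if $w_i=w_{i+1}$ and $2$ if $w_i\ne w_{i+1}$; $g(\omega)=[\overline{2,a_0,\ldots,a_t}]$ is the purely periodic infinite continued fraction with period $(2,a_0,\ldots,a_t)$. For positive integers $i,j$, a cyclic shift of this period (a finite sequence of 1s and 2s) is said to be of type $(i,j)$ if it has the form $(2,\underbrace{1,\ldots,1}_{2(i-1)},Y,\underbrace{1,\ldots,1}_{2(j-1)})$, where $Y$ is a finite sequence of 1s and 2s whose first and last entries are $2$ (possibly $Y=(2)$); i.e. the shift $[\overline{2,1,\ldots,1,2,\ldots,2,1,\ldots,1}]$ of $g(\omega)$ begins with $2$, then $2(i-1)$ ones, then $2$, arbitrary terms, $2$, and ends with $2(j-1)$ ones. For irrational $\alpha$, $L(\alpha)=\sup\{L: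 |\frac pq-\alpha|<\frac{1}{Lq^2}\text{ for infinitely many reduced }\frac pq\}$ and $L(\omega):=L(g(\omega))$. *)

(* Defs.v *)
From HB Require Import structures.
From mathcomp Require Import all_boot all_order all_algebra.
From mathcomp Require Import all_classical all_reals all_analysis.
Import Order.TTheory GRing.Theory Num.Theory.
Import numFieldNormedType.Exports.

Set Implicit Arguments.
Unset Strict Implicit.
Unset Printing Implicit Defensive.

Local Open Scope classical_set_scope.
Local Open Scope ring_scope.

Inductive step := stepR | stepU.

Definition is_stepU (x : step) : bool := if x is stepU then true else false.
Definition step_of_bool (u : bool) : step := if u then stepU else stepR.

Lemma is_stepUK : cancel is_stepU step_of_bool.
Proof. by case. Qed.

HB.instance Definition _ := Equality.copy step (can_type is_stepUK).

Definition lattice_path (a b : nat) (w : seq step) : Prop :=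
  count_mem stepR w = a /\ count_mem stepU w = b.

(* The half-plane y <= (b/a) x is convex, so a path lies in it as soon as its
   vertices, the endpoints of the prefixes of w, do; for a > 0 the inequality
   below is y <= (b/a) x at such a vertex, with the denominator cleared. *)
Definition below_diagonal (a b : nat) (w : seq step) : Prop :=
  forall m : nat,
    (a * count_mem stepU (take m w) <= b * count_mem stepR (take m w))%N.

(* The set D(a,b). *)
Definition Dpath (a b : nat) (w : seq step) : Prop :=
  lattice_path a b w /\ below_diagonal a b w.

(* The entry sequence [a_0, ..., a_t] of f(w). *)
Fixpoint f_entries (w : seq step) : seq nat :=
  match w with
  | x :: ((y :: _) as w') =>
      (if x == y then [:: 1; 1]%N else [:: 2]%N) ++ f_entries w'
  | _ => [::]
  end.

Definition g_period (w : seq step) : seq nat := 2%N :: f_entries w.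

(* The default value 0 of head and last rules out an empty Y; Y = (2) is
   allowed. *)
Definition of_type (i j : nat) (s : seq nat) : Prop :=
  exists Y : seq nat,
    [/\ all (mem [:: 1; 2]%N) Y, head 0%N Y = 2%N, last 0%N Y = 2%N
      & s = 2%N :: nseq (2 * (i - 1)) 1%N ++ Y ++ nseq (2 * (j - 1)) 1%N].

Definition shift_of_type (i j : nat) (s : seq nat) : Prop :=
  exists m : nat, of_type i j (rot m s).

Section Reals.
Variable R : realType.

(* The value of the empty continued fraction is junk. *)
Fixpoint cf_eval (s : seq nat) : R :=
  match s with
  | [::] => 0
  | [:: c] => c%:R
  | c :: s' => c%:R + 1 / cf_eval s'
  end.

Definition cf_convergent (c : nat -> nat) (n : nat) : R :=
  cf_eval (mkseq c n.+1).

Definition cf_value (c : nat -> nat) : R :=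
  lim (cf_convergent c n @[n --> \oo]).

Definition periodic_entries (s : seq nat) (n : nat) : nat :=
  nth 0%N s (n %% size s).

Definition g_value (w : seq step) : R := cf_value (periodic_entries (g_period w)).

(* A reduced fraction p/q is an element r of rat, with q = denq r > 0.  No
   L <= 0 satisfies the condition: the bound is then <= 0 (for L = 0 because
   0^-1 = 0).  The supremum is taken in the extended reals. *)
Definition approximable (alpha L : R) : Prop :=
  infinite_set [set r : rat |
    `|ratr r - alpha| < 1 / (L * (denq r)%:~R ^+ 2)].

Definition lagrange (alpha : R) : \bar R :=
  ereal_sup [set L%:E | L in [set L : R | approximable alpha L]].

Definition path_lagrange (w : seq step) : \bar R := lagrange (g_value w).

End Reals.

(* Main.v *)
(** For alpha = [c_0; c_1, ...] with convergents p_n/q_n,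
    |alpha - p_n/q_n| = 1/(q_n^2 M_n) with
    M_n = [c_(n+1); c_(n+2), ...] + [0; c_n, ..., c_1], and by Legendre every
    fraction within 1/(2 q^2) of alpha is a convergent, so L(alpha) is governed
    by the values M_n for large n.  If c_(n+1) = 1 then M_n <= 5/2.  If
    c_(n+1) = 2, the sequence read forwards (backwards) from there starts with
    2p (2q) ones followed by a 2, where the shift at n+1 has type (p+1, q+1).
    The map t |-> [1, ..., 1, t] with 2p ones is increasing in t and
    [1, 1, 3] = 7/4 < 7/3 = [2, 3]; hence more ones on both sides increase M_n
    by an amount bounded below, uniformly in n. *)
Require Import Defs.
From mathcomp Require Import all_boot all_order all_algebra.
From mathcomp Require Import all_classical all_reals all_analysis.
From mathcomp Require Import zify ring lra.
Import Order.TTheory GRing.Theory Num.Theory.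
Import numFieldNormedType.Exports.

Set Implicit Arguments.
Unset Strict Implicit.
Unset Printing Implicit Defensive.

Local Open Scope classical_set_scope.
Local Open Scope ring_scope.

(** * Values of continued fractions with entries 1 and 2 *)

Definition cf_step (R : realType) (c : nat) (t : R) : R := c%:R + t^-1.

Definition entries12 (c : nat -> nat) : Prop := forall n, (0 < c n <= 2)%N.

(* With the convention 1/0 = 0 a last entry c equals c + 1/0, so no case
   distinction on the end of the list is needed. *)
Lemma cf_evalE (R : realType) (s : seq nat) :
  cf_eval R s = foldr (@cf_step R) 0 s.
Proof.
elim: s => //= x [|y s] IH; first by rewrite /= /cf_step invr0 addr0.
by rewrite IH /cf_step div1r.
Qed.

Lemma entries12_itv (R : realType) (c : nat) :
  (0 < c <= 2)%N -> 1 <= c%:R :> R /\ c%:R <= 2 :> R.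
Proof. by case/andP=> ? ?; rewrite ler1n ler_nat. Qed.

Lemma inv_itv (R : realType) (t a b : R) :
  0 < a -> a <= t -> t <= b -> b^-1 <= t^-1 <= a^-1.
Proof. by move=> a0 ta tb; rewrite !lef_pV2 ?posrE ?ta ?tb //; lra. Qed.

(** The endpoints are 1 + 1/3 and 2 + 1/1. That 4/3 exceeds 1 makes later steps contracting. *)
Lemma cf_step_itv (R : realType) (c : nat) (t : R) :
  (0 < c <= 2)%N -> 1 <= t <= 3 -> 4 / 3 <= cf_step c t <= 3.
Proof.
move=> /(entries12_itv R)[? ?] /andP[t1 t3].
have /andP[] := inv_itv ltr01 t1 t3; rewrite /cf_step invr1; lra.
Qed.

Lemma itv43 (R : realType) (t : R) : 4 / 3 <= t <= 3 -> 1 <= t <= 3.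
Proof. by move=> /andP[? ?]; apply/andP; split; lra. Qed.

Lemma cf_fold_itv1 (R : realType) (x : nat) (s : seq nat) :
  all (fun c => 0 < c <= 2)%N (x :: s) ->
  1 <= foldr (@cf_step R) 0 (x :: s) <= 3.
Proof.
elim: s x => [|y s IH] x.
  by rewrite /= andbT /cf_step invr0 => /(entries12_itv R)[? ?]; lra.
by move=> /= /andP[x12 /IH /(cf_step_itv x12) /itv43].
Qed.

Lemma cf_fold_itv (R : realType) (x y : nat) (s : seq nat) :
  all (fun c => 0 < c <= 2)%N [:: x, y & s] ->
  4 / 3 <= foldr (@cf_step R) 0 [:: x, y & s] <= 3.
Proof. by move=> /= /andP[x12 /(cf_fold_itv1 R) /(cf_step_itv x12)]. Qed.

(** |1/t - 1/t'| = |t - t'| / (t t'), and t t' >= (4/3)^2. *)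
Lemma cf_step_contract (R : realType) (c : nat) (t t' : R) :
  4 / 3 <= t -> 4 / 3 <= t' ->
  `|cf_step c t - cf_step c t'| <= 9 / 16 * `|t - t'|.
Proof.
move=> t1 t'1.
have -> : cf_step c t - cf_step c t' = (t' - t) * (t^-1 * t'^-1).
  by rewrite /cf_step; field; apply/andP; split; lra.
rewrite normrM distrC mulrC ler_wpM2r //.
have i0 (u : R) : 4 / 3 <= u -> 0 <= u^-1 <= 3 / 4.
  move=> hu; rewrite invr_ge0; apply/andP; split; first by lra.
  by rewrite -[3 / 4]invf_div lef_pV2 ?posrE; lra.
have /andP[? ?] := i0 _ t1; have /andP[? ?] := i0 _ t'1.
by rewrite ger0_norm ?mulr_ge0 //; nra.
Qed.

Lemma cf_fold_contract (R : realType) (s : seq nat) (t t' : R) :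
  all (fun c => 0 < c <= 2)%N s -> 4 / 3 <= t <= 3 -> 4 / 3 <= t' <= 3 ->
  `|foldr (@cf_step R) t s - foldr (@cf_step R) t' s| <=
    (9 / 16) ^+ size s * `|t - t'|.
Proof.
move=> + ht ht'; elim: s => [|x s IH] /=; first by rewrite mul1r.
case/andP=> x12 s12.
have st (u : R) : 4 / 3 <= u <= 3 -> 4 / 3 <= foldr (@cf_step R) u s.
  move=> hu; suff /andP[] : 4 / 3 <= foldr (@cf_step R) u s <= 3 by [].
  elim: s s12 {IH} => [|y s IHs] //= /andP[y12 /IHs /itv43].
  exact: cf_step_itv.
apply: le_trans (cf_step_contract x (st _ ht) (st _ ht')) _.
by rewrite exprS -[leRHS]mulrA ler_wpM2l ?IH //; lra.
Qed.

Lemma entries12_all (c : nat -> nat) (n m : nat) :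
  entries12 c -> all (fun c => 0 < c <= 2)%N (map c (iota n m)).
Proof. by move=> h; apply/allP => x /mapP[i _ ->]. Qed.

Lemma cf_convergent_split (R : realType) (c : nat -> nat) (n m : nat) :
  cf_convergent R c (n + m)%N =
  foldr (@cf_step R) (foldr (@cf_step R) 0 (map c (iota n m.+1))) (map c (iota 0 n)).
Proof.
by rewrite /cf_convergent cf_evalE /mkseq -addnS iotaD map_cat foldr_cat add0n.
Qed.

Lemma cf_convergent_cvg (R : realType) (c : nat -> nat) :
  entries12 c -> cvg (cf_convergent R c n @[n --> \oo]).
Proof.
move=> c12; apply/cauchy_cvgP/cauchy_exP => e e0.
have [N hN] : exists N, 2 * (9 / 16) ^+ N < e.
  have /cvgrPdist_lt /(_ (e / 2)) : (fun n => (9 / 16 : R) ^+ n) @ \oo --> (0 : R).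
    by apply: cvg_expr; rewrite ger0_norm; lra.
  case; first by lra.
  move=> N _ /(_ N (leqnn N)) /=; rewrite sub0r normrN ger0_norm.
    by move=> ?; exists N; lra.
  by apply: exprn_ge0; lra.
(* Index N + 1 leaves at least two entries after the common first N, so the tails lie in [4/3, 3]
   and differ by less than 2; a one-entry tail may equal 1. *)
exists (cf_convergent R c (N + 1)); exists (N + 1)%N => // m /= Nm.
rewrite -(subnKC Nm) -addnA !cf_convergent_split /ball /=.
have itv j : 4 / 3 <= foldr (@cf_step R) 0 (map c (iota N (1 + j).+1)) <= 3.
  exact: (cf_fold_itv R (entries12_all N j.+2 c12)).
have := cf_fold_contract (entries12_all 0 N c12) (itv 0%N) (itv (m - (N + 1))%N).
rewrite size_map size_iota => /le_lt_trans; apply.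
apply: le_lt_trans hN; rewrite mulrC ler_wpM2r //.
have /andP[? ?] := itv 0%N; have /andP[? ?] := itv (m - (N + 1))%N.
by rewrite ler_norml; apply/andP; split; lra.
Qed.

Lemma cf_value_itv1 (R : realType) (c : nat -> nat) :
  entries12 c -> 1 <= cf_value R c <= 3.
Proof.
move=> c12; have cv := @cf_convergent_cvg R c c12.
have h n : 1 <= cf_convergent R c n <= 3.
  by rewrite /cf_convergent cf_evalE; apply: cf_fold_itv1 (entries12_all 0 n.+1 c12).
apply/andP; split.
  by apply: limr_ge => //; apply: nearW => n; case/andP: (h n).
by apply: limr_le => //; apply: nearW => n; case/andP: (h n).
Qed.

Lemma cf_convergentS (R : realType) (c : nat -> nat) (n : nat) :
  cf_convergent R c n.+1 =
  cf_step (c 0%N) (cf_convergent R (fun i => c i.+1) n).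
Proof.
rewrite /cf_convergent !cf_evalE /mkseq.
have e k : map c (iota 0 k.+1) = c 0%N :: map (fun i => c i.+1) (iota 0 k).
  by rewrite /= (iotaDl 1 0 k : iota 1 k = _) -map_comp.
by rewrite e.
Qed.

(** The recursion of the convergents passes to the limit, as the limit of the tail is at least 1 and
    inversion is continuous there. *)
Lemma cf_value_step (R : realType) (c : nat -> nat) :
  entries12 c -> cf_value R c = cf_step (c 0%N) (cf_value R (fun i => c i.+1)).
Proof.
move=> c12; apply: cvg_lim => //.
have c12' : entries12 (fun i => c i.+1) by move=> n; apply: c12.
have /andP[v1 _] := @cf_value_itv1 R _ c12'.
rewrite -(cvg_shiftS (cf_convergent R c)).
have -> : [sequence cf_convergent R c n.+1]_n =
    (fun n => cf_step (c 0%N) (cf_convergent R (fun i => c i.+1) n)).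
  by apply/funext => n; exact: cf_convergentS.
apply: cvgD; first exact: cvg_cst.
by apply: cvgV; [lra | exact: cf_convergent_cvg].
Qed.

(** The complete quotient [c_n; c_(n+1), ...]. *)
Definition cf_from (R : realType) (c : nat -> nat) (n : nat) : R :=
  cf_value R (fun i => c (n + i)%N).

Lemma cf_fromS (R : realType) (c : nat -> nat) (n : nat) :
  entries12 c -> cf_from R c n = cf_step (c n) (cf_from R c n.+1).
Proof.
move=> c12; rewrite /cf_from cf_value_step ?addn0; last by move=> i; apply: c12.
by congr (cf_step _ (cf_value R _)); apply/funext => i; rewrite addnS.
Qed.

Lemma cf_from_itv (R : realType) (c : nat -> nat) (n : nat) :
  entries12 c -> 4 / 3 <= cf_from R c n <= 3.
Proof.
move=> c12; rewrite cf_fromS //; apply: cf_step_itv => //.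
by apply: cf_value_itv1 => i; apply: c12.
Qed.

(** * Convergents and best approximation *)

(* The index is shifted by one from the usual convention, so that the
   convergent p_n / q_n is [cf_num c n.+1 / cf_den c n.+1]. *)
Fixpoint continuant (c : nat -> nat) (u v : int) (n : nat) : int :=
  match n with
  | 0 => u
  | n'.+1 => if n' is n''.+1 then
               (c n')%:Z * continuant c u v n' + continuant c u v n''
             else v
  end.

Definition cf_num (c : nat -> nat) : nat -> int := continuant c 1 (c 0%N).
Definition cf_den (c : nat -> nat) : nat -> int := continuant c 0 1.

Lemma cf_numSS (c : nat -> nat) (n : nat) :
  cf_num c n.+2 = (c n.+1)%:Z * cf_num c n.+1 + cf_num c n.
Proof. by []. Qed.

Lemma cf_denSS (c : nat -> nat) (n : nat) :
  cf_den c n.+2 = (c n.+1)%:Z * cf_den c n.+1 + cf_den c n.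
Proof. by []. Qed.

Lemma cf_det (c : nat -> nat) (n : nat) :
  cf_num c n.+1 * cf_den c n - cf_num c n * cf_den c n.+1 = (-1) ^+ n.+1.
Proof.
elim: n => [|n IH]; first by rewrite /= mulr0 mulr1 expr1 sub0r.
by rewrite cf_numSS cf_denSS exprS -IH; ring.
Qed.

Lemma cf_den_gt0 (c : nat -> nat) (n : nat) :
  entries12 c -> 0 < cf_den c n.+1.
Proof.
move=> c12; suff : (0 < cf_den c n.+1) && (0 <= cf_den c n) by case/andP.
elim: n => // n /andP[IH1 IH0]; have := c12 n.+1.
by rewrite cf_denSS; nia.
Qed.

Lemma cf_den_ge0 (c : nat -> nat) (n : nat) :
  entries12 c -> 0 <= cf_den c n.
Proof. by case: n => // n /(cf_den_gt0 n)/ltW. Qed.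

Lemma cf_den_leS (c : nat -> nat) (n : nat) :
  entries12 c -> cf_den c n <= cf_den c n.+1.
Proof.
case: n => // n c12; have := c12 n.+1; have := cf_den_gt0 n c12.
by have := cf_den_ge0 n c12; rewrite cf_denSS; nia.
Qed.

Lemma cf_den_ge (c : nat -> nat) (n : nat) :
  entries12 c -> n%:Z <= cf_den c n.+1.
Proof.
move=> c12; elim: n => // -[|n] IH; first by have := cf_den_gt0 1 c12; lia.
have := c12 n.+2; have := cf_den_gt0 n c12; have := cf_den_gt0 n.+1 c12.
by rewrite (cf_denSS c n.+1); nia.
Qed.

(** A largest n with q_n <= q exists since q_n >= n; maximality copes with the possible tie q_0 =
    q_1. *)
Lemma cf_den_floor (c : nat -> nat) (q : int) :
  entries12 c -> 0 < q ->
  exists n, cf_den c n.+1 <= q /\ q < cf_den c n.+2.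
Proof.
move=> c12 q0.
have ex : exists n, cf_den c n.+1 <= q.
  by exists 0%N; rewrite -[cf_den c 1]/(1 : int); lia.
have bd n : cf_den c n.+1 <= q -> (n <= `|q|)%N.
  by have := cf_den_ge n c12; lia.
case: (ex_maxnP ex bd) => n hn hmax; exists n; split => //.
by rewrite ltNge; apply/negP => /hmax; rewrite ltnn.
Qed.

Definition cf_err (R : realType) (c : nat -> nat) (n : nat) : R :=
  cf_from R c 0 * (cf_den c n)%:~R - (cf_num c n)%:~R.

Lemma cf_from_gt1 (R : realType) (c : nat -> nat) (n : nat) :
  entries12 c -> 1 < cf_from R c n.
Proof. by move=> /(cf_from_itv R n)/andP[? _]; lra. Qed.

(** The errors inherit the recurrence of p_n and q_n, which matches x_n = c_n + 1/x_(n+1) for the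
    complete quotients. *)
Lemma cf_errS (R : realType) (c : nat -> nat) (n : nat) :
  entries12 c -> cf_err R c n = - cf_from R c n.+1 * cf_err R c n.+1.
Proof.
move=> c12; elim: n => [|n IH].
  have := cf_from_gt1 R 1 c12.
  rewrite /cf_err /cf_den /cf_num /= (cf_fromS R 0) // /cf_step => ?.
  by rewrite -pmulrn; field; lra.
have := cf_from_gt1 R n.+2 c12 => ?.
have -> : cf_err R c n.+2 = (c n.+1)%:R * cf_err R c n.+1 + cf_err R c n.
  by rewrite /cf_err cf_numSS cf_denSS !rmorphD !rmorphM /= -!pmulrn; ring.
rewrite IH (cf_fromS R n.+1) // /cf_step; field; lra.
Qed.

(** This is M_n, as q_(n-1)/q_n = [0; c_n, ..., c_1]. *)
Definition markov_num (R : realType) (c : nat -> nat) (n : nat) : R :=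
  cf_from R c n.+1 + (cf_den c n)%:~R / (cf_den c n.+1)%:~R.

(** With e_n = q_n alpha - p_n, [cf_errS] turns the product inside the absolute value into q_(n-1)
    e_n - q_n e_(n-1); there alpha cancels and the determinant of [cf_det] remains up to sign. *)
Lemma cf_errM (R : realType) (c : nat -> nat) (n : nat) :
  entries12 c ->
  `|cf_err R c n.+1| * ((cf_den c n.+1)%:~R * markov_num R c n) = 1.
Proof.
move=> c12; have ? := cf_from_gt1 R n.+1 c12.
have q0 : 0 < (cf_den c n.+1)%:~R :> R by rewrite ltr0z cf_den_gt0.
have q0' : 0 <= (cf_den c n)%:~R :> R by rewrite ler0z cf_den_ge0.
have -> : (cf_den c n.+1)%:~R * markov_num R c n =
    (cf_den c n.+1)%:~R * cf_from R c n.+1 + (cf_den c n)%:~R.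
  by rewrite /markov_num; field; lra.
rewrite -[X in _ * X]ger0_norm -?normrM; last by nra.
have -> : cf_err R c n.+1 *
    ((cf_den c n.+1)%:~R * cf_from R c n.+1 + (cf_den c n)%:~R) =
    (cf_den c n)%:~R * cf_err R c n.+1 - (cf_den c n.+1)%:~R * cf_err R c n.
  by rewrite (cf_errS R n c12); ring.
have -> : (cf_den c n)%:~R * cf_err R c n.+1 - (cf_den c n.+1)%:~R * cf_err R c n
   = - (cf_num c n.+1 * cf_den c n - cf_num c n * cf_den c n.+1)%:~R.
  by rewrite /cf_err rmorphB !rmorphM /=; ring.
by rewrite cf_det normrN rmorphXn /= rmorphN1 normrX normrN1 expr1n.
Qed.

Lemma cf_errS_lt (R : realType) (c : nat -> nat) (n : nat) :
  entries12 c -> `|cf_err R c n.+1| < `|cf_err R c n|.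
Proof.
move=> c12; rewrite (cf_errS R n c12) normrM normrN.
have x1 := cf_from_gt1 R n.+1 c12; rewrite (gtr0_norm (lt_trans ltr01 x1)).
have : 0 < `|cf_err R c n.+1|.
  rewrite normr_gt0; apply/eqP => e0; have := cf_errM R n c12.
  by rewrite e0 normr0 mul0r => /esym/eqP; rewrite oner_eq0.
by nra.
Qed.

(* Write (p, q) = u (p_n, q_n) + v (p_(n+1), q_(n+1)) with u, v integers.  As
   0 < q < q_(n+1), u <> 0 and u v <= 0; the errors of consecutive convergents
   have opposite signs, so the two contributions to the error of p/q add up. *)
Lemma best_approximation (R : realType) (c : nat -> nat) (n : nat) (p q : int) :
  entries12 c -> 0 < q -> q < cf_den c n.+2 ->
  `|cf_err R c n.+1| <= `|cf_from R c 0 * q%:~R - p%:~R|.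
Proof.
move=> c12 q0 qlt.
(* Cramer's rule: the determinant d is a sign, hence its own inverse, so u and v are integers. *)
pose d := (-1) ^+ n.+2 : int.
have dd : d * d = 1 by rewrite -expr2 sqrr_sign.
pose u := d * (cf_num c n.+2 * q - p * cf_den c n.+2).
pose v := d * (p * cf_den c n.+1 - cf_num c n.+1 * q).
have det := cf_det c n.+1.
have qE : q = u * cf_den c n.+1 + v * cf_den c n.+2.
  transitivity (d * d * q); first by rewrite dd mul1r.
  by rewrite /u /v {1}/d -det; ring.
have pE : p = u * cf_num c n.+1 + v * cf_num c n.+2.
  transitivity (d * d * p); first by rewrite dd mul1r.
  by rewrite /u /v {1}/d -det; ring.
clearbody u v; have Q1 := cf_den_gt0 n c12; have Q2 := cf_den_gt0 n.+1 c12.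
have u0 : u != 0.
  by apply/eqP => u0; move: qE; rewrite u0 mul0r add0r; have [v1|v1] := lerP v 0; nia.
have uv : u * v <= 0.
  rewrite leNgt; apply/negP => uv; have [u1|u1] := ltrP 0 u.
    have v1 : 0 < v by nia.
    nia.
  have v1 : v < 0 by nia.
  nia.
have -> : cf_from R c 0 * q%:~R - p%:~R =
    (u%:~R - v%:~R / cf_from R c n.+2) * cf_err R c n.+1.
  have xx := cf_from_gt1 R n.+2 c12.
  transitivity (u%:~R * cf_err R c n.+1 + v%:~R * cf_err R c n.+2).
    rewrite {1}qE {1}pE /cf_err.
    move: (cf_num c n.+1) (cf_num c n.+2) (cf_den c n.+1) (cf_den c n.+2) => *.
    by rewrite !intrD !intrM; ring.
  rewrite (cf_errS R n.+1 c12); field; exact: lt0r_neq0 (lt_trans ltr01 xx).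
rewrite normrM ler_peMl //.
have xx : 0 < (cf_from R c n.+2)^-1.
  by rewrite invr_gt0; have := cf_from_gt1 R n.+2 c12; lra.
have [u1|u1] := ltrP 0 u.
  have v1 : v <= 0 by nia.
  have : 1 <= u%:~R :> R by rewrite ler1z.
  have : v%:~R <= 0 :> R by rewrite lerz0.
  by move=> *; rewrite ger0_norm; nra.
have v1 : 0 <= v by nia.
have : u%:~R <= -1 :> R.
  by rewrite (_ : -1 = (-1)%:~R) ?ler_int; [lia | rewrite rmorphN1].
have : 0 <= v%:~R :> R by rewrite ler0z.
by move=> *; rewrite ler0_norm; nra.
Qed.

(** * Legendre's criterion and the Lagrange number *)

Definition cf_conv_rat (c : nat -> nat) (n : nat) : rat :=
  (cf_num c n.+1)%:~R / (cf_den c n.+1)%:~R.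

Lemma ratr_num_den (R : realType) (r : rat) :
  ratr r = (numq r)%:~R / (denq r)%:~R :> R.
Proof. by []. Qed.

(* The bound q_n <= q replaces the equality that holds because both fractions
   are reduced. *)
Lemma legendre (R : realType) (c : nat -> nat) (r : rat) :
  entries12 c ->
  `|ratr r - cf_from R c 0| < 1 / (2 * (denq r)%:~R ^+ 2) ->
  exists2 n, cf_den c n.+1 <= denq r & r = cf_conv_rat c n.
Proof.
move=> c12 hr; set q := denq r; set p := numq r.
have q0 : 0 < q by exact: denq_gt0.
have [n [Qq qQ]] := cf_den_floor c12 q0; exists n => //.
have hb := best_approximation R p c12 q0 qQ.
have Q0 := cf_den_gt0 n c12.
have qR : 0 < q%:~R :> R by rewrite ltr0z.
have QR : 0 < (cf_den c n.+1)%:~R :> R by rewrite ltr0z.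
have QqR : (cf_den c n.+1)%:~R <= q%:~R :> R by rewrite ler_int.
have he : q%:~R * `|cf_from R c 0 * q%:~R - p%:~R| < 1 / 2.
  have -> : cf_from R c 0 * q%:~R - p%:~R = - q%:~R * (ratr r - cf_from R c 0).
    by rewrite ratr_num_den -/p -/q; field; exact: lt0r_neq0.
  rewrite normrM normrN (gtr0_norm qR) mulrA -expr2.
  rewrite -ltr_pdivlMl ?exprn_gt0 //; apply: lt_le_trans hr _.
  by rewrite -/q le_eqVlt; apply/orP; left; apply/eqP; field; exact: lt0r_neq0.
(* The integer p q_n - p_n q vanishes: its absolute value is at most q |e_n| + q_n |q alpha - p| <=
   2 q |q alpha - p| < 1. *)
have eqpq : p * cf_den c n.+1 = cf_num c n.+1 * q.
  apply/eqP; rewrite -subr_eq0 -[_ == 0]negbK -normr_gt0 -leNgt -ltzD1 add0r.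
  rewrite -(ltr_int R) intr_norm rmorphB !rmorphM /=.
  have -> : p%:~R * (cf_den c n.+1)%:~R - (cf_num c n.+1)%:~R * q%:~R =
     q%:~R * cf_err R c n.+1 -
     (cf_den c n.+1)%:~R * (cf_from R c 0 * q%:~R - p%:~R).
    by rewrite /cf_err; ring.
  apply: le_lt_trans (ler_normB _ _) _.
  rewrite !normrM (gtr0_norm qR) (gtr0_norm QR).
  move: hb he.
  move: `|_| `|_ - _| (normr_ge0 (cf_from R c 0 * q%:~R - p%:~R)) => x y y0 xy.
  have : q%:~R * x <= q%:~R * y by rewrite ler_pM2l.
  have : (cf_den c n.+1)%:~R * y <= q%:~R * y by rewrite ler_wpM2r.
  by lra.
rewrite /cf_conv_rat -[r in LHS]divq_num_den -/p -/q.
apply/eqP; rewrite eqr_div ?intr_eq0 ?lt0r_neq0 //.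
by rewrite -!intrM eqpq.
Qed.

Lemma markov_num_gt0 (R : realType) (c : nat -> nat) (n : nat) :
  entries12 c -> 0 < markov_num R c n.
Proof.
move=> c12; rewrite /markov_num ltr_pwDl //.
  by have := cf_from_gt1 R n.+1 c12; lra.
by rewrite divr_ge0 // ler0z ?cf_den_ge0 // ltW // cf_den_gt0.
Qed.

Lemma cf_conv_dist (R : realType) (c : nat -> nat) (n : nat) :
  entries12 c ->
  `|ratr (cf_conv_rat c n) - cf_from R c 0| =
    `|cf_err R c n.+1| / (cf_den c n.+1)%:~R.
Proof.
move=> c12; have Q0 : 0 < (cf_den c n.+1)%:~R :> R by rewrite ltr0z cf_den_gt0.
rewrite /cf_conv_rat fmorph_div /= !ratr_int -[in RHS](gtr0_norm Q0).
rewrite -normf_div distrC /cf_err; congr `|_|; field; exact: lt0r_neq0.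
Qed.

Lemma cf_conv_distE (R : realType) (c : nat -> nat) (n : nat) :
  entries12 c ->
  `|ratr (cf_conv_rat c n) - cf_from R c 0| =
    1 / (markov_num R c n * (cf_den c n.+1)%:~R ^+ 2).
Proof.
move=> c12; have Q0 : 0 < (cf_den c n.+1)%:~R :> R by rewrite ltr0z cf_den_gt0.
have M0 := markov_num_gt0 R n c12.
rewrite cf_conv_dist // -[X in X / _](cf_errM R n c12); field.
by rewrite !lt0r_neq0.
Qed.

Lemma cf_conv_dist_lt (R : realType) (c : nat -> nat) (m n : nat) :
  entries12 c -> (m < n)%N ->
  `|ratr (cf_conv_rat c n) - cf_from R c 0| <
  `|ratr (cf_conv_rat c m) - cf_from R c 0|.
Proof.
move=> c12; pose f i := `|ratr (cf_conv_rat c i) - cf_from R c 0|.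
apply: (@homo_ltn _ f (fun x y => y < x)) => [y x z yx zy|i].
  exact: lt_trans zy yx.
rewrite /f !cf_conv_dist //.
have Q0 : 0 < (cf_den c i.+1)%:~R :> R by rewrite ltr0z cf_den_gt0.
have Q1 : 0 < (cf_den c i.+2)%:~R :> R by rewrite ltr0z cf_den_gt0.
apply: (@le_lt_trans _ _ (`|cf_err R c i.+2| / (cf_den c i.+1)%:~R)).
  by rewrite ler_wpM2l // lef_pV2 // ler_int cf_den_leS.
by rewrite ltr_pM2r ?invr_gt0 // cf_errS_lt.
Qed.

(** The distances to alpha strictly decrease. Thus infinitely many indices give infinitely many
    fractions. *)
Lemma cf_conv_inj (R : realType) (c : nat -> nat) :
  entries12 c -> injective (cf_conv_rat c).
Proof.
move=> c12 m n e; have [lt_mn|lt_nm|//] := ltngtP m n.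
  by have := cf_conv_dist_lt R c12 lt_mn; rewrite e ltxx.
by have := cf_conv_dist_lt R c12 lt_nm; rewrite e ltxx.
Qed.

(** An infinite set keeps a fraction p/q after the first N convergents are removed. As L >= 2,
    Legendre's criterion applies to it, and q_n <= q gives 1/(L q^2) <= 1/(L q_n^2). *)
Lemma approximable_markov (R : realType) (c : nat -> nat) (L : R) (N : nat) :
  entries12 c -> 2 <= L -> approximable (cf_from R c 0) L ->
  exists2 n, (N <= n)%N & L < markov_num R c n.
Proof.
move=> c12 L2 appr.
have fin : finite_set (cf_conv_rat c @` `I_N) by apply: finite_image.
have [r [/= hr rN]] := infinite_setN0 (infinite_setD appr fin).
have q0 : 0 < (denq r)%:~R :> R by rewrite ltr0z denq_gt0.
have [|n Qq rE] := @legendre R c r c12.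
  apply: lt_le_trans hr _; rewrite ler_pdivlMr ?mulr_gt0 ?exprn_gt0 //.
  rewrite mul1r mulrC ler_pdivrMr ?mulr_gt0 ?exprn_gt0 ?mul1r //; last by lra.
  by rewrite ler_pM2r ?exprn_gt0.
exists n.
  by rewrite leqNgt; apply/negP => nN; apply: rN; exists n.
have M0 := markov_num_gt0 R n c12.
have Q0 : 0 < (cf_den c n.+1)%:~R :> R by rewrite ltr0z cf_den_gt0.
have QqR : (cf_den c n.+1)%:~R <= (denq r)%:~R :> R by rewrite ler_int.
have L0 : 0 < L by lra.
move: hr; rewrite {1}rE cf_conv_distE // !div1r ltf_pV2 ?posrE ?mulr_gt0 ?exprn_gt0 //.
move=> h; have : L * (cf_den c n.+1)%:~R ^+ 2 <= L * (denq r)%:~R ^+ 2.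
  by rewrite ler_pM2l // ler_pXn2r // nnegrE ltW.
by move=> /le_lt_trans /(_ h); rewrite ltr_pM2r ?exprn_gt0.
Qed.

(** Reduction divides the denominator by a positive integer; a smaller denominator only relaxes the
    inequality in [approximable]. *)
Lemma denq_conv_le (c : nat -> nat) (n : nat) :
  entries12 c -> denq (cf_conv_rat c n) <= cf_den c n.+1.
Proof.
move=> c12; have := cf_den_gt0 n c12; rewrite /cf_conv_rat.
case: divqP => // k x _; have := denq_gt0 x.
move: (denq x) => d d0; have [k0|k0] := lerP k 0; nia.
Qed.

Lemma markov_approximable (R : realType) (c : nat -> nat) (L : R) :
  entries12 c -> 0 < L ->
  (forall N, exists2 n, (N <= n)%N & L < markov_num R c n) ->
  approximable (cf_from R c 0) L.
Proof.
move=> c12 L0 hL; rewrite /approximable; set S := (X in infinite_set X) => finS.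
have sub n : L < markov_num R c n -> S (cf_conv_rat c n).
  move=> h; have M0 := markov_num_gt0 R n c12.
  have Q0 : 0 < (cf_den c n.+1)%:~R :> R by rewrite ltr0z cf_den_gt0.
  have q0 : 0 < (denq (cf_conv_rat c n))%:~R :> R by rewrite ltr0z denq_gt0.
  rewrite /S /= cf_conv_distE // !div1r ltf_pV2 ?posrE ?mulr_gt0 ?exprn_gt0 //.
  apply: (@le_lt_trans _ _ (L * (cf_den c n.+1)%:~R ^+ 2)).
    by rewrite ler_pM2l // ler_pXn2r ?ler_int ?denq_conv_le // nnegrE ltW.
  by rewrite ltr_pM2r ?exprn_gt0.
have /finite_seqP[s sE] : finite_set (cf_conv_rat c @^-1` S).
  by apply: finite_preimage finS => m n _ _; exact: (cf_conv_inj R c12).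
(* An index beyond the finite list s of all indices with convergent in S gives the contradiction. *)
have [n sn /sub] := hL (\max_(i <- s) i).+1.
rewrite -[S _]/((cf_conv_rat c @^-1` S) n) sE /= => /(@leq_bigmax_seq _ s xpredT id n).
by move=> /(_ isT) /(leq_trans sn); rewrite ltnn.
Qed.

(** * Runs of ones *)

Definition step11 (R : realType) (t : R) : R := cf_step 1 (cf_step 1 t).

(** [1, ..., 1, t] with 2p ones; one step is decreasing in t, so pairs of steps are increasing. *)
Definition ones_cf (R : realType) (p : nat) (t : R) : R := iter p (@step11 R) t.

Lemma cf_step_lt (R : realType) (c : nat) (t u : R) :
  0 < t -> t < u -> cf_step c u < cf_step c t.
Proof. by move=> t0 tu; rewrite /cf_step ltrD2l ltf_pV2 // posrE; lra. Qed.

Lemma step11_itv (R : realType) (t : R) : 1 <= t <= 3 -> 1 <= step11 t <= 7 / 4.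
Proof.
move=> ht; have t12 : (0 < 1 <= 2)%N by [].
have := cf_step_itv t12 ht => /andP[h1 h2].
rewrite /step11; move: (cf_step 1 t) h1 h2 => u u1 u3; rewrite /cf_step.
have : 0 < u^-1 by rewrite invr_gt0; lra.
have : u^-1 <= 3 / 4 by rewrite -[3 / 4]invf_div lef_pV2 ?posrE; lra.
by move=> *; apply/andP; split; lra.
Qed.

Lemma ones_cf_itv (R : realType) (p : nat) (t : R) :
  1 <= t <= 3 -> 1 <= ones_cf p t <= 3.
Proof.
by move=> ht; elim: p => //= p /step11_itv /andP[? ?]; apply/andP; split; lra.
Qed.

Lemma ones_cf_lt (R : realType) (p : nat) (t u : R) :
  1 <= t -> t < u -> u <= 3 -> ones_cf p t < ones_cf p u.
Proof.
move=> t1 tu u3; elim: p => //= p IH.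
have /andP[a1 a3] : 1 <= ones_cf p t <= 3 by apply: ones_cf_itv; lra.
apply: cf_step_lt; first by rewrite /cf_step; have := @invr_ge0 R (ones_cf p u); lra.
by apply: cf_step_lt => //; lra.
Qed.

Lemma ones_cf_le (R : realType) (p : nat) (t u : R) :
  1 <= t -> t <= u -> u <= 3 -> ones_cf p t <= ones_cf p u.
Proof.
move=> t1; rewrite le_eqVlt => /predU1P[->//|tu] u3.
exact: ltW (ones_cf_lt p t1 tu u3).
Qed.

(** Further pairs of ones replace the tail 7/3 by a value at most 7/4, and [ones_cf p] is
    increasing. *)
Lemma ones_cf_anti (R : realType) (p q : nat) :
  (p <= q)%N -> ones_cf q (7 / 3 : R) <= ones_cf p (7 / 3).
Proof.
move=> pq.
have -> : ones_cf q (7 / 3 : R) = ones_cf p (ones_cf (q - p) (7 / 3)).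
  by rewrite /ones_cf -iterD subnKC.
have h m : 1 <= ones_cf m (7 / 3 : R) <= 3 by apply: ones_cf_itv; lra.
case: (q - p)%N => // m.
have /step11_itv/andP[a1 a2] := h m.
rewrite -[ones_cf m.+1 _]/(step11 (ones_cf m (7 / 3))).
by apply: ones_cf_le; lra.
Qed.

(** This is the gap between runs of different length: tails beginning with 2 lie in [7/3, 3], and
    even the largest becomes [1, 1, 3] = 7/4 < 7/3 behind two ones. *)
Lemma ones_cfS_lt (R : realType) (p : nat) :
  ones_cf p.+1 (3 : R) < ones_cf p (7 / 3).
Proof.
have -> : ones_cf p.+1 (3 : R) = ones_cf p (step11 3) by rewrite /ones_cf iterSr.
have -> : step11 (3 : R) = 7 / 4 by rewrite /step11 /cf_step; field.
by apply: ones_cf_lt; lra.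
Qed.

Definition ones_then_two (d : nat -> nat) (p : nat) : Prop :=
  (forall i, (i < 2 * p)%N -> d i = 1%N) /\ d (2 * p)%N = 2%N.

(** The sequence y is abstract to serve both directions: complete quotients forwards, [den_ratio]
    backwards. The tails are 7/3 = 2 + 1/3 and 3 = 2 + 1. *)
Lemma ones_then_two_bounds (R : realType) (y : nat -> R) (d : nat -> nat) (p : nat) :
  (forall i, (i <= 2 * p)%N -> y i = cf_step (d i) (y i.+1)) ->
  ones_then_two d p -> 1 <= y (2 * p).+1 <= 3 ->
  ones_cf p (7 / 3) <= y 0%N <= ones_cf p 3.
Proof.
move=> hy [d1 d2] hend.
have -> : y 0%N = ones_cf p (y (2 * p)%N).
  elim: p y d hy d1 {d2 hend} => [|p IH] y d hy d1; first by rewrite muln0.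
  rewrite hy // d1 ?mulnS // (hy 1%N) ?mulnS // d1 ?mulnS //.
  rewrite (IH (fun i => y i.+2) (fun i => d i.+2)) //.
    by move=> i ip; apply: hy; rewrite mulnS.
  by move=> i ip; apply: d1; rewrite mulnS.
have /andP[y1 y3] := hend.
have i1 : (y (2 * p).+1)^-1 <= 1 by rewrite invf_le1; lra.
have i3 : 1 / 3 <= (y (2 * p).+1)^-1.
  by rewrite div1r lef_pV2 ?posrE; lra.
have : y (2 * p)%N = 2 + (y (2 * p).+1)^-1 by rewrite hy // d2.
by move=> ->; apply/andP; split; apply: ones_cf_le; lra.
Qed.

(** q_n/q_(n-1) = [c_n; ..., c_1]. Its value 0 at n = 0, with 1/0 = 0, lets the recursion start
    there. *)
Definition den_ratio (R : realType) (c : nat -> nat) (n : nat) : R :=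
  (cf_den c n.+1)%:~R / (cf_den c n)%:~R.

Lemma den_ratioS (R : realType) (c : nat -> nat) (n : nat) :
  entries12 c -> den_ratio R c n.+1 = cf_step (c n.+1) (den_ratio R c n).
Proof.
move=> c12; have Q0 : 0 < (cf_den c n.+1)%:~R :> R by rewrite ltr0z cf_den_gt0.
rewrite /den_ratio /cf_step invf_div cf_denSS rmorphD rmorphM /= -pmulrn.
by field; exact: lt0r_neq0.
Qed.

Lemma den_ratio_itv (R : realType) (c : nat -> nat) (n : nat) :
  entries12 c -> (0 < n)%N -> 1 <= den_ratio R c n <= 3.
Proof.
move=> c12; case: n => // n _.
have Q0 : 0 < (cf_den c n.+1)%:~R :> R by rewrite ltr0z cf_den_gt0.
rewrite den_ratioS // /cf_step /den_ratio invf_div.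
have [a1 a2] := entries12_itv R (c12 n.+1).
have b0 : 0 <= (cf_den c n)%:~R / (cf_den c n.+1)%:~R :> R.
  by rewrite divr_ge0 ?ler0z ?cf_den_ge0.
have b1 : (cf_den c n)%:~R / (cf_den c n.+1)%:~R <= 1 :> R.
  by rewrite ler_pdivrMr // mul1r ler_int cf_den_leS.
by apply/andP; split; lra.
Qed.

Lemma markov_numE (R : realType) (c : nat -> nat) (n : nat) :
  entries12 c ->
  markov_num R c n =
    (c n.+1)%:R + (cf_from R c n.+2)^-1 + (den_ratio R c n)^-1.
Proof. by move=> c12; rewrite /markov_num cf_fromS // /den_ratio invf_div. Qed.

(** 5/2 = 1 + 3/4 + 3/4; for n > 1 the backward fraction has two entries, so [den_ratio] is at least
    4/3. *)
Lemma markov_num_one (R : realType) (c : nat -> nat) (n : nat) :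
  entries12 c -> (1 < n)%N -> c n.+1 = 1%N -> markov_num R c n <= 5 / 2.
Proof.
move=> c12 n1 c1; rewrite markov_numE // c1.
have inv34 (u : R) : 4 / 3 <= u -> u^-1 <= 3 / 4.
  by move=> h; rewrite -[3 / 4]invf_div lef_pV2 ?posrE; lra.
have : 4 / 3 <= den_ratio R c n <= 3.
  case: n n1 {c1} => [|[|n]] // _; rewrite den_ratioS //.
  exact: (cf_step_itv (c12 _) (den_ratio_itv _ _ _)).
move=> /andP[/inv34 ? _].
by have /andP[/inv34 ? _] := cf_from_itv R n.+2 c12; lra.
Qed.

(** Reciprocals swap the bounds, so the tail 3 gives the lower one. The condition on q keeps n - 2q
    - 1, the last index of the backward reading, positive. *)
Lemma markov_num_two (R : realType) (c : nat -> nat) (n p q : nat) :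
  entries12 c -> (2 * q < n.-1)%N -> c n.+1 = 2%N ->
  ones_then_two (fun i => c (n.+2 + i)%N) p ->
  ones_then_two (fun i => c (n - i)%N) q ->
  2 + (ones_cf p 3)^-1 + (ones_cf q 3)^-1 <= markov_num R c n <=
  2 + (ones_cf p (7 / 3))^-1 + (ones_cf q (7 / 3))^-1.
Proof.
move=> c12 qn c2 hp hq; rewrite markov_numE // c2.
have x_itv := cf_from_itv R _ c12.
have /andP[x1 x2] : ones_cf p (7 / 3) <= cf_from R c n.+2 <= ones_cf p 3.
  rewrite -[n.+2]addn0.
  apply: (ones_then_two_bounds (y := fun i => cf_from R c (n.+2 + i)) _ hp).
    by move=> i _; rewrite addnS -cf_fromS.
  exact: itv43.
have /andP[y1 y2] : ones_cf q (7 / 3) <= den_ratio R c n <= ones_cf q 3.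
  rewrite -[n]subn0.
  apply: (ones_then_two_bounds (y := fun i => den_ratio R c (n - i)) _ hq).
    move=> i iq; have -> : (n - i = (n - i.+1).+1)%N by lia.
    exact: den_ratioS.
  by apply: den_ratio_itv => //; lia.
have pos s (t : R) : 7 / 3 <= t <= 3 -> 0 < ones_cf s t.
  by move=> ht; have /andP[? ?] : 1 <= ones_cf s t <= 3; [apply: ones_cf_itv|]; lra.
have anti (s t : R) : 0 < s -> s <= t -> t^-1 <= s^-1.
  by move=> s0 st; rewrite lef_pV2 ?posrE //; lra.
have p7 s : 0 < ones_cf s (7 / 3 : R) by apply: pos; lra.
have := anti _ _ (p7 p) x1; have := anti _ _ (p7 q) y1.
have := anti _ _ (lt_le_trans (p7 p) x1) x2.
have := anti _ _ (lt_le_trans (p7 q) y1) y2.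
by move=> *; apply/andP; split; lra.
Qed.

(** * Positions of the entry 2 in a period *)

(** The Boolean tells whether two adjacent letters differ; working with blocks makes all runs of
    ones even. *)
Definition block (b : bool) : seq nat := if b then [:: 2%N] else [:: 1%N; 1%N].

Lemma f_entries_blocks (w : seq step) :
  exists bs, f_entries w = flatten (map block bs).
Proof.
elim: w => [|x [|y w] IH]; [by exists [::] | by exists [::] |].
have [bs e] := IH; exists ((x != y) :: bs).
by rewrite /= -e /=; case: (x == y).
Qed.

(** Without an entry 2 adjacent letters agree, so the word is constant. *)
Lemma f_entries_has2 (w : seq step) (x y : step) :
  x \in w -> y \in w -> x != y -> 2%N \in f_entries w.
Proof.
move=> xw yw xy; apply: contraT => no2.
suff h z : z \in w -> z = head stepR w.
  by rewrite (h x) // (h y) // eqxx in xy.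
elim: w no2 {xw yw} z => //= u [|v w] IH; first by move=> _ z; rewrite inE => /eqP.
rewrite mem_cat negb_or => /andP[]; case: eqP => // -> _ /IH {}IH z.
by rewrite inE => /predU1P[//|/IH].
Qed.

Lemma mem_block2 (bs : seq bool) :
  (2%N \in flatten (map block bs)) = (true \in bs).
Proof. by elim: bs => //= -[] bs IH; rewrite mem_cat IH. Qed.

Lemma flatten_block12 (bs : seq bool) :
  all (mem [:: 1; 2]%N) (flatten (map block bs)).
Proof. by elim: bs => //= -[] bs IH; rewrite all_cat IH. Qed.

Lemma flatten_ones (p : nat) :
  flatten (map block (nseq p false)) = nseq (2 * p) 1%N.
Proof. by elim: p => // p IH; rewrite mulnS nseqD -IH. Qed.

Lemma flatten_block_nth2 (bs : seq bool) (m : nat) :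
  nth 0%N (flatten (map block bs)) m = 2%N ->
  exists bs1 bs2, bs = bs1 ++ true :: bs2 /\ size (flatten (map block bs1)) = m.
Proof.
elim: bs m => [|b bs IH] m; first by rewrite nth_nil.
case: b => /=.
  case: m => [_|m /IH[bs1 [bs2 [-> <-]]]]; first by exists [::], bs.
  by exists (true :: bs1), bs2.
case: m => [|[|m]] //= /IH[bs1 [bs2 [-> <-]]].
by exists (false :: bs1), bs2.
Qed.

Lemma split_true (bs : seq bool) :
  true \in bs ->
  exists p bs', bs = nseq p false ++ true :: bs'.
Proof.
elim: bs => // -[] bs IH; first by exists 0%N, bs.
by rewrite inE => /IH[p [bs' ->]]; exists p.+1, bs'.
Qed.

Lemma split_last_true (bs : seq bool) :
  exists q bs', true :: bs = rcons bs' true ++ nseq q false.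
Proof.
have : true \in rev (true :: bs) by rewrite mem_rev mem_head.
move=> /split_true[q [bs' e]]; exists q, (rev bs').
by rewrite -[LHS]revK e rev_cat rev_cons rev_nseq.
Qed.

(** Y runs from the first to the last block 2, which may coincide; only pairs of ones remain
    outside. *)
Lemma of_type_blocks (bs : seq bool) :
  true \in bs -> exists p q,
    of_type p.+1 q.+1 (2%N :: flatten (map block bs)).
Proof.
move=> /split_true[p [bs' ->]].
have [q [bs'' e]] := split_last_true bs'; exists p, q.
exists (flatten (map block (rcons bs'' true))); split.
- exact: flatten_block12.
- by case: bs'' e => [|b bs''] //= [<-].
- by rewrite map_rcons flatten_rcons last_cat.
- by rewrite e !map_cat !flatten_cat !flatten_ones !subn1.
Qed.

(** An entry 2 is a whole block, so the rotation cuts between blocks and yields a block sequence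
    again. *)
Lemma shift_of_type_nth2 (bs : seq bool) (m : nat) :
  let s := 2%N :: flatten (map block bs) in
  true \in bs -> nth 0%N s m = 2%N ->
  exists p q, of_type p.+1 q.+1 (rot m s).
Proof.
move=> s tbs /(@flatten_block_nth2 (true :: bs) m)[bs1 [bs2 [e <-]]].
have sE : s = flatten (map block (bs1 ++ true :: bs2)) by rewrite -e.
rewrite sE map_cat flatten_cat rot_size_cat -flatten_cat -map_cat /=.
apply: of_type_blocks; rewrite mem_cat orbC.
(* A second 2 remains: if the shift is trivial it comes from [bs], otherwise it is the original
   leading 2, moved behind the cut. *)
case: bs1 e {sE} => [[<-]|b bs1 [<- ebs]]; first by rewrite tbs orbT.
by rewrite mem_head.
Qed.

Lemma rot_mod (s : seq nat) (m : nat) :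
  (0 < size s)%N -> exists2 m', (m' < size s)%N & rot m s = rot m' s.
Proof.
move=> s0; have [ms|sm] := ltnP m (size s); first by exists m.
by exists 0%N; rewrite // rot0 rot_oversize.
Qed.

Lemma nth_rot_mod (s : seq nat) (m i : nat) :
  (m < size s)%N -> (i < size s)%N ->
  nth 0%N (rot m s) i = nth 0%N s ((m + i) %% size s).
Proof.
move=> ms is_; rewrite /rot nth_cat size_drop nth_drop.
case: ltnP => h; first by rewrite modn_small //; lia.
rewrite nth_take; last by lia.
rewrite (_ : m + i = i - (size s - m) + size s)%N; last by lia.
by rewrite modnDr modn_small //; lia.
Qed.

Lemma periodic_rot (s : seq nat) (m n i : nat) :
  (m < size s)%N -> n = m %[mod size s] ->
  periodic_entries s (n + i) = periodic_entries (rot m s) i.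
Proof.
move=> ms nm; rewrite /periodic_entries size_rot nth_rot_mod //; last first.
  by rewrite ltn_mod; lia.
by rewrite modnDmr -modnDml nm modnDml.
Qed.

Lemma periodic_entries12 (s : seq nat) :
  (0 < size s)%N -> all (mem [:: 1; 2]%N) s -> entries12 (periodic_entries s).
Proof.
move=> s0 /allP h n; have /h : nth 0%N s (n %% size s) \in s.
  by rewrite mem_nth // ltn_mod.
by rewrite /periodic_entries !inE => /orP[]/eqP->.
Qed.

(** The rotated period is read forwards from its start at n + 1 and, by periodicity, backwards from
    its end at n. As n >= [size s], the subtractions n - i do not truncate. *)
Lemma of_type_pattern (s : seq nat) (m n p q : nat) :
  (m < size s)%N -> of_type p.+1 q.+1 (rot m s) ->
  (size s <= n)%N -> n.+1 = m %[mod size s] ->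
  let c := periodic_entries s in
  [/\ c n.+1 = 2%N, ones_then_two (fun i => c (n.+2 + i)%N) p,
      ones_then_two (fun i => c (n - i)%N) q & (2 * q < n.-1)%N].
Proof.
move=> ms [Y [_ hY lY]]; rewrite !subn1 /= => e sn nm.
have [Y0 Y'E] : exists Y1, Y = 2%N :: Y1 by case: Y hY {lY e} => //= y Y1 ->; exists Y1.
have [Y2 YE] : exists Y2, Y = rcons Y2 2%N.
  by case/lastP: Y lY {hY e Y'E} => // Y2 y; rewrite last_rcons => ->; exists Y2.
have ss : size s = (2 * p + size Y + 2 * q).+1.
  by rewrite -(size_rot m) e /= !size_cat !size_nseq addnA.
have sY : (0 < size Y)%N by rewrite Y'E.
have fwd i : (i < size s)%N -> periodic_entries s (n.+1 + i) = nth 0%N (rot m s) i.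
  by move=> h; rewrite (periodic_rot i ms nm) /periodic_entries size_rot modn_small.
have bwd i : (i < size s)%N ->
    periodic_entries s (n - i) = nth 0%N (rot m s) ((size s).-1 - i).
  move=> h; rewrite -fwd; last by lia.
  rewrite /periodic_entries; congr nth.
  by rewrite (_ : n.+1 + ((size s).-1 - i) = n - i + size s)%N ?modnDr //; lia.
split.
- by rewrite -[n.+1]addn0 fwd ?e //; lia.
- split=> [i ip|]; rewrite addSnnS fwd ?e /=; try lia.
    by rewrite nth_cat size_nseq ip nth_nseq ip.
  by rewrite nth_cat size_nseq ltnn subnn Y'E.
- have bk i : (i < size Y + 2 * q)%N ->
     nth 0%N (rot m s) ((size s).-1 - i) =
     nth 0%N (Y ++ nseq (2 * q) 1%N) (size Y + 2 * q - i).-1.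
    move=> h; rewrite e ss /=.
    rewrite (_ : _ - _ = (2 * p + (size Y + 2 * q - i).-1).+1)%N; last by lia.
    by rewrite /= nth_cat size_nseq ltnNge leq_addr /= addKn.
  split=> [i iq|]; rewrite bwd ?bk; try lia.
    rewrite nth_cat ltnNge (_ : size Y <= _)%N /=; last by lia.
    by rewrite nth_nseq ifT //; lia.
  rewrite addnK nth_cat prednK // leqnn YE size_rcons /=.
  by rewrite nth_rcons ltnn eqxx.
- by lia.
Qed.

(** * Comparison of Lagrange numbers *)

Lemma g_period_entries12 (w : seq step) :
  entries12 (periodic_entries (g_period w)).
Proof.
apply: periodic_entries12 => //; rewrite /g_period.
by have [bs ->] := f_entries_blocks w; rewrite /= flatten_block12.
Qed.

(** Both letters occur in w, so its entries contain a 2 besides the leading one, from which Y can be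
    built. *)
Lemma Dpath_period_two (a b : nat) (w : seq step) (m : nat) :
  (0 < b)%N -> (b < a)%N -> Dpath a b w -> nth 0%N (g_period w) m = 2%N ->
  exists p q, of_type p.+1 q.+1 (rot m (g_period w)).
Proof.
move=> b0 ba [[cR cU] _]; have [bs e] := f_entries_blocks w.
have wR : stepR \in w by rewrite -has_pred1 has_count cR; lia.
have wU : stepU \in w by rewrite -has_pred1 has_count cU.
have := f_entries_has2 wR wU isT; rewrite /g_period e mem_block2.
exact: shift_of_type_nth2.
Qed.

(** The upper bound for M_n at type (p+1, q+1); the arguments count pairs of ones. *)
Definition type_bound (R : realType) (p q : nat) : R :=
  2 + (ones_cf p (7 / 3))^-1 + (ones_cf q (7 / 3))^-1.

Lemma type_bound_le (R : realType) (p q p' q' : nat) :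
  (p <= p')%N -> (q <= q')%N -> type_bound R p q <= type_bound R p' q'.
Proof.
have pos s : 0 < ones_cf s (7 / 3 : R).
  by have /andP[? ?] : 1 <= ones_cf s (7 / 3 : R) <= 3; [apply: ones_cf_itv|]; lra.
move=> /(ones_cf_anti R) hp /(ones_cf_anti R) hq.
by rewrite lerD ?lerD2l ?lef_pV2 ?posrE.
Qed.

Lemma markov_num_le_type_bound (R : realType) (a b : nat) (w : seq step)
    (k l n : nat) :
  (0 < b)%N -> (b < a)%N -> Dpath a b w ->
  (forall i j : nat, (0 < i)%N -> (0 < j)%N -> shift_of_type i j (g_period w) ->
     ((i < k.+2)%N /\ (j < l.+2)%N) \/ ((i < l.+2)%N /\ (j < k.+2)%N)) ->
  (size (g_period w) < n)%N ->
  markov_num R (periodic_entries (g_period w)) n <= type_bound R k l.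
Proof.
move=> b0 ba hw htype sn.
have c12 := g_period_entries12 w; set s := g_period w in sn c12 *.
have s0 : (0 < size s)%N by [].
(* 2 + 1/3 + 1/3 > 5/2 settles the positions with entry 1. *)
have B0 : 5 / 2 <= type_bound R k l.
  have inv3 t : 1 / 3 <= (ones_cf t (7 / 3 : R))^-1.
    have /andP[? ?] : 1 <= ones_cf t (7 / 3 : R) <= 3 by apply: ones_cf_itv; lra.
    by rewrite div1r lef_pV2 ?posrE; lra.
  by have := inv3 k; have := inv3 l; rewrite /type_bound; lra.
have [c1|c2] : periodic_entries s n.+1 = 1%N \/ periodic_entries s n.+1 = 2%N.
  by have := c12 n.+1; lia.
  by apply: le_trans (markov_num_one R c12 _ c1) B0; lia.
have ms : (n.+1 %% size s < size s)%N by rewrite ltn_mod.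
have [p [q pq]] := Dpath_period_two b0 ba hw c2.
have [_ hp hq qn] := of_type_pattern ms pq (ltnW sn) (esym (modn_mod _ _)).
have /andP[_ /le_trans] := markov_num_two R c12 qn c2 hp hq; apply.
have [|[pk ql]|[pl qk]] := htype p.+1 q.+1 isT isT; first by exists (n.+1 %% size s)%N.
- exact: type_bound_le.
- by rewrite addrAC; apply: type_bound_le.
Qed.

Lemma markov_num_ge_type (R : realType) (w : seq step) (k l N : nat) :
  shift_of_type k.+1 l.+1 (g_period w) ->
  exists2 n, (N <= n)%N &
    2 + (ones_cf k 3)^-1 + (ones_cf l 3)^-1 <=
      markov_num R (periodic_entries (g_period w)) n.
Proof.
have c12 := g_period_entries12 w; set s := g_period w in c12 *.
have s0 : (0 < size s)%N by [].
move=> [m0]; have [m ms ->] := rot_mod m0 s0 => kl.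
(* The rotation starts at n + 1, hence the predecessor; [N.+2] periods make n at least N and at
   least [size s]. *)
exists (m + N.+2 * size s).-1; first by nia.
have [|//|c2 hk hl ln] := of_type_pattern (n := (m + N.+2 * size s).-1) ms kl.
- by nia.
- by rewrite prednK ?modnMDl 1?addnC ?modnMDl //; nia.
by have /andP[] := markov_num_two R c12 ln c2 hk hl.
Qed.

Theorem theorem4p2 (R : realType) (a b : nat) (hb : (0 < b)%N)
    (hab : (b < a)%N) (hcop : coprime a b)
    (w w' : seq step) (hw : Dpath a b w) (hw' : Dpath a b w')
    (k l : nat) (hk : (0 < k)%N) (hl : (0 < l)%N)
    (htype' : shift_of_type k l (g_period w'))
    (htype : forall i j : nat, (0 < i)%N -> (0 < j)%N ->
       shift_of_type i j (g_period w) ->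
       ((i < k)%N /\ (j < l)%N) \/ ((i < l)%N /\ (j < k)%N)) :
  (path_lagrange R w < path_lagrange R w')%E.
Proof.
(* The unshifted period of w begins with 2 and so has some type (p+1, q+1); [htype] then forces k, l
   >= 2. *)
have [k' [l' [kE lE]]] : exists k' l', k = k'.+2 /\ l = l'.+2.
  have [p [q pq]] := Dpath_period_two hb hab hw (erefl : nth 0%N (g_period w) 0 = 2%N).
  have := htype p.+1 q.+1 isT isT (ex_intro _ 0%N pq).
  by exists k.-2, l.-2; lia.
subst k l => {hk hl}.
have c12 := g_period_entries12 w; have c12' := g_period_entries12 w'.
(* The types of w are at most (k'+1, l'+1) up to order, so C bounds M_n from above for large n. The
   type (k'+2, l'+2) of w' makes M_n >= C' infinitely often. *)
pose C := type_bound R k' l'.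
pose C' := 2 + (ones_cf k'.+1 (3 : R))^-1 + (ones_cf l'.+1 3)^-1.
have C2 : 2 <= C.
  have pos s : 0 <= (ones_cf s (7 / 3 : R))^-1.
    have /andP[? ?] : 1 <= ones_cf s (7 / 3 : R) <= 3 by apply: ones_cf_itv; lra.
    by rewrite invr_ge0; lra.
  by have := pos k'; have := pos l'; rewrite /C /type_bound; lra.
have CC' : C < C'.
  have lt_inv s : (ones_cf s (7 / 3 : R))^-1 < (ones_cf s.+1 3)^-1.
    have /andP[? ?] : 1 <= ones_cf s.+1 (3 : R) <= 3 by apply: ones_cf_itv; lra.
    by have := ones_cfS_lt R s => ?; rewrite ltf_pV2 ?posrE; lra.
  by have := lt_inv k'; have := lt_inv l'; rewrite /C /C' /type_bound; lra.
apply: (@le_lt_trans _ _ C%:E).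
  apply: ge_ereal_sup => _ [L /= appr <-]; rewrite lee_fin leNgt; apply/negP => CL.
  have [|n sn] := approximable_markov (size (g_period w)).+1 c12 _ appr; first lra.
  have := markov_num_le_type_bound R hb hab hw htype sn; rewrite -/C; lra.
(* [markov_approximable] asks for L < M_n while only C' <= M_n is known, hence the midpoint. *)
apply: (@lt_le_trans _ _ ((C + C') / 2)%:E); first by rewrite lte_fin; lra.
apply: ereal_sup_ubound; exists ((C + C') / 2) => //=.
apply: (markov_approximable c12'); first lra.
move=> N; have [n Nn hn] := markov_num_ge_type R N htype'; exists n => //.
by move: hn; rewrite -/C'; lra.
Qed.
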